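(* Let $\gamma < \kappa$ be infinite cardinals. Give $[\kappa]^\kappa$ the topology $\Sigma([\kappa]^{<\gamma}, [\kappa]^{<\gamma})$ and give $\gamma$ the discrete topology, and let $c : [\kappa]^\kappa \to \gamma$ be continuous. Then there is some $H \in [\kappa]^\kappa$ that is homogeneous for $c$ (i.e. $c$ is constant on $[H]^\kappa$) with $|\kappa - H| \le \gamma$. If moreover $\gamma$ is a regular cardinal, then there is such an $H$ with $|\kappa - H| < \gamma$.
   Context: For an ordinal $\kappa$ and ordinal $\delta$, $[\kappa]^\delta$ is the set of subsets of $\kappa$ of order type $\delta$ and $[\kappa]^{<\delta}$ the set of subsets of $\kappa$ of order type $<\delta$. A pattern is a pair $(A,B)$ of disjoint subsets of $\kappa$; a set $X \in [\kappa]^\kappa$ matches $(A,B)$ iff $A \subseteq X$ and $B \cap X = \emptyset$; $[A;B]$ denotes the set of all $X \in [\kappa]^\kappa$ matching $(A,B)$. For $\mathcal{A}, \mathcal{B} \subseteq \mathcal{P}(\kappa)$, $\Sigma(\mathcal{A},\mathcal{B})$ is the collection of all subsets of $[\kappa]^\kappa$ that are unions of sets $[A;B]$ with $(A,B)$ a pattern, $A \in \mathcal{A}$, $B \in \mathcal{B}$. Here $\Sigma([\kappa]^{<\gamma}, [\kappa]^{<\gamma})$ is a topology on $[\kappa]^\kappa$ with basic open sets $[A;B]$, $A,B$ disjoint of size $<\gamma$. *)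

(* Defs.v *)
Set Warnings "-notation-overridden,-notation-incompatible-prefix".
From HB Require Import structures.
From mathcomp Require Import all_boot all_order.
From mathcomp Require Import all_classical topology.

Set Implicit Arguments.
Unset Strict Implicit.
Unset Printing Implicit Defensive.

Import Order.TTheory.

Local Open Scope order_scope.
Local Open Scope card_scope.
Local Open Scope classical_set_scope.

Definition card_lt T U (A : set T) (B : set U) : Prop :=
  A #<= B /\ ~ (B #<= A).

Definition below d (T : orderType d) (x : T) : set T := [set y | y < x].

(* A cardinal is an initial ordinal, and an ordinal is a well-ordered type;
   the elements of the type are the smaller ordinals. *)
Record infinite_cardinal d (T : orderType d) : Prop := InfiniteCardinal {
  cardinal_wf : well_founded (fun x y : T => x < y);
  cardinal_initial : forall x : T, card_lt (below x) [set: T];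
  cardinal_infinite : infinite_set [set: T]
}.

Definition order_iso d (T : orderType d) d' (U : orderType d')
    (A : set T) (B : set U) : Prop :=
  exists f : T -> U, set_bij A B f /\ {in A &, {mono f : x y / x <= y}}.

(* [T]^U; as in the next definition, T is an implicit argument *)
Definition sets_of_type d (T : orderType d) d' (U : orderType d') :
  set (set T) := [set A | order_iso A [set: U]].

(* [T]^{<U}: an ordinal < U is a proper initial segment of U *)
Definition sets_of_type_lt d (T : orderType d) d' (U : orderType d') :
  set (set T) := [set A | exists u : U, order_iso A (below u)].

(* [T]^T, as a type *)
Definition full_sets d (T : orderType d) : Type :=
  {X : set T | sets_of_type T X}.

(* cf(T) = T, as cf(T) is the least order type of a cofinal subset of T *)
Definition regular_cardinal d (T : orderType d) : Prop :=
  infinite_cardinal T /\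
  forall A : set T, (forall x, exists2 y, A y & x <= y) ->
    ~ sets_of_type_lt T A.

Section patterns.
Context d (T : orderType d).
Implicit Types A B : set T.

Definition pattern A B : Prop := A `&` B = set0.

Definition matches (X : full_sets T) A B : Prop :=
  A `<=` sval X /\ B `&` sval X = set0.

Definition bracket A B : set (full_sets T) := [set X | matches X A B].

Definition Sigma (SA SB : set (set T)) : set (set (full_sets T)) :=
  [set U | exists P : set (set T * set T),
    (forall p, P p -> [/\ pattern p.1 p.2, SA p.1 & SB p.2]) /\
    U = \bigcup_(p in P) bracket p.1 p.2].

Lemma SigmaP SA SB U : Sigma SA SB U <->
  forall X, U X -> exists A B,
    [/\ pattern A B, SA A, SB B, bracket A B X & bracket A B `<=` U].
Proof.
split=> [[P [hP ->]] X [[A B] PAB XAB]|hU].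
  have [? ? ?] := hP _ PAB.
  by exists A, B; split=> // Y YAB; exists (A, B).
exists [set p | [/\ pattern p.1 p.2, SA p.1, SB p.2 &
                    bracket p.1 p.2 `<=` U]]; split; first by move=> p [].
apply/seteqP; split=> [X /hU[A [B [? ? ? ? ?]]]|X [p [_ _ _ +] ?]].
  by exists (A, B).
exact.
Qed.

End patterns.

Section cardinality_facts.

Lemma card_le_fun T U (u0 : U) (A : set T) (B : set U) : A #<= B ->
  exists2 f : T -> U, set_fun A B f & set_inj A f.
Proof.
elim/Ppointed: U => U in B u0 *; first by have := no u0.
by move=> /pcard_leP/injfunPex.
Qed.

Lemma fun_card_le T U (f : T -> U) (A : set T) (B : set U) :
  set_fun A B f -> set_inj A f -> A #<= B.
Proof.
move=> fAB /inj_card_eq/card_eqPle[_ fA]; apply: card_le_trans fA _.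
by apply: subset_card_le => _ [x Ax <-]; exact: fAB.
Qed.

Lemma infinite_setU1_card_le T (A : set T) (x : T) :
  infinite_set A -> x |` A #<= A.
Proof.
move=> Ainf; have [Ax|Ax] := pselect (A x).
  by apply: subset_card_le => y [->|].
have [f fA fI] := card_le_fun x ((infiniteP A).1 Ainf).
have fE m n : f m = f n -> m = n by move=> e; apply: fI; rewrite ?inE.
pose N y := xget 0%N [set n | f n = y].
have NE n : N (f n) = n.
  by apply: fE; rewrite /N; apply: (xgetPex 0%N (P := [set m | f m = f n])); exists n.
pose g y := if `[< y = x >] then f 0%N else
  if `[< exists n, f n = y >] then f (N y).+1 else y.
have gx : g x = f 0%N by rewrite /g; case: asboolP.
have gf n : g (f n) = f n.+1.
  rewrite /g; case: asboolP => [e|_]; first by case: Ax; rewrite -e; exact: fA.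
  by case: asboolP => [_|[]]; [rewrite NE | exists n].
have gN y : y <> x -> ~ (exists n, f n = y) -> g y = y.
  by rewrite /g => yx ny; case: asboolP => // _; case: asboolP.
have cases y : [\/ y = x, exists n, f n = y |
    [/\ y <> x, ~ (exists n, f n = y) & g y = y]].
  have [|yx] := pselect (y = x); first by constructor 1.
  have [|ny] := pselect (exists n, f n = y); first by constructor 2.
  by constructor 3; split=> //; exact: gN.
apply: (@fun_card_le _ _ g).
  move=> y; case: (cases y) => [->|[n <-]|[yx ny ->]].
  - by rewrite gx => _; exact: fA.
  - by rewrite gf => _; exact: fA.
  - by case.
move=> y z _ _; case: (cases y) => [->|[n <-]|[yx ny ->]];
  case: (cases z) => [->|[m <-]|[zx nz ->]]; rewrite ?gx ?gf //.
- by move/fE.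
- by move=> e; case: nz; exists 0%N.
- by move/fE.
- by move/fE=> [->].
- by move=> e; case: nz; exists n.+1.
- by move=> e; case: ny; exists 0%N.
- by move=> e; case: ny; exists m.+1.
Qed.

Section well_ordered.
Context d (T : orderType d) (wfT : well_founded (fun x y : T => x < y)).

Lemma wf_min (A : set T) : A !=set0 ->
  exists2 m, A m & forall x, A x -> m <= x.
Proof.
move=> [x]; elim/(well_founded_ind wfT): x => x IH Ax.
have [[y [Ay yx]]|nx] := pselect (exists y, A y /\ y < x); first exact: IH Ay.
by exists x => // y Ay; rewrite leNgt; apply/negP => yx; apply: nx; exists y.
Qed.

(* Each element of a limit ordinal is uniquely l + n with l not a successor;
   (l + n, i) |-> l + 2n + i is injective. *)
Lemma limit_card_le_setXbool (m : T) :
  (forall x, x < m -> exists2 y, x < y & y < m) ->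
  below m `*` [set: bool] #<= below m.
Proof.
move=> lim.
have /choice[s sP] (x : T) : exists y, x < m ->
    [/\ x < y, y < m & forall z, x < z -> y <= z].
  have [xm|xm] := pselect (x < m); last by exists x.
  have [|y xy ymin] := @wf_min [set y | x < y].
    by have [y xy _] := lim _ xm; exists y.
  have [z xz zm] := lim _ xm.
  by exists y => _; split=> //; exact: le_lt_trans (ymin _ xz) zm.
have s_inj x y : x < m -> y < m -> s x = s y -> x = y.
  move=> xm ym e; have [xsx sxm sx] := sP _ xm; have [ysy sym sy] := sP _ ym.
  case: (ltgtP x y) => // [/sx|/sy].
  - by rewrite e leNgt ysy.
  - by rewrite -e leNgt xsx.
have sn n l : l < m -> iter n s l < m.
  by move=> lm; elim: n => //= n /sP[].
pose limit l := l < m /\ forall x, x < m -> s x <> l.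
have ex x : exists ln, x < m -> limit ln.1 /\ x = iter ln.2 s ln.1.
  elim/(well_founded_ind wfT): x => x IH.
  have [xm|xm] := pselect (x < m); last by exists (x, 0%N).
  have [[y [ym yx]]|nx] := pselect (exists y, y < m /\ s y = x).
    have [ysy _ _] := sP _ ym; rewrite yx in ysy.
    have [[l n] /(_ ym)/=[ll yE]] := IH _ ysy.
    by exists (l, n.+1) => _ /=; split=> //; rewrite -yE yx.
  by exists (x, 0%N) => _; split=> //; split=> // y ym yx; apply: nx; exists y.
have uniq n n' l l' : limit l -> limit l' ->
    iter n s l = iter n' s l' -> n = n' /\ l = l'.
  move=> ll ll'; elim: n n' => [|n IH] [|n'] //= e.
  - by case: ll => _ /(_ (iter n' s l')) []; [apply: sn; case: ll'|rewrite e].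
  - by case: ll' => _ /(_ (iter n s l)) []; [apply: sn; case: ll|].
  - have [|<- <-//] := IH n'.
    by apply: s_inj e; apply: sn; [case: ll|case: ll'].
have [ln lnP] := choice ex.
pose F (p : T * bool) := iter (p.2 + (ln p.1).2.*2) s (ln p.1).1.
apply: (@fun_card_le _ _ F) => [[x i] [/= /lnP[[lm _] _] _]|]; first exact: sn.
move=> [x i] [y j]; rewrite !inE => -[/= /lnP[lx xE] _] [/= /lnP[ly yE] _].
move=> /(uniq _ _ _ _ lx ly)/=[e1 e2]; have ij : i = j.
  by have := congr1 odd e1; rewrite !oddD !odd_double !addbF; case: i j {e1} => -[].
rewrite ij in e1 *; move/addnI/double_inj: e1 => e1.
by rewrite xE yE e1 e2.
Qed.

Lemma infinite_card_le_setXbool (b : T) : infinite_set (below b) ->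
  below b `*` [set: bool] #<= below b.
Proof.
move=> binf.
have [|m bm mmin] := @wf_min [set m | below b #<= below m].
  by exists b; exact: card_lexx.
have minf : infinite_set (below m) by move=> /(card_le_finite bm).
have mb : m <= b by apply: mmin; exact: card_lexx.
have lim x : x < m -> exists2 y, x < y & y < m.
  move=> xm; apply: contrapT => nlim.
  have mE : below m `<=` x |` below x.
    move=> y ym; case: (ltgtP y x) => [| |->]; [by right| |by left] => xy.
    by case: nlim; exists y.
  have xinf : infinite_set (below x).
    move=> xfin; apply: minf; apply: sub_finite_set mE _.
    by rewrite finite_setU; split=> //; exact: finite_set1.
  suff /mmin : below b #<= below x by rewrite leNgt xm.
  apply: card_le_trans bm _; apply: card_le_trans (subset_card_le mE) _.
  exact: infinite_setU1_card_le.
have [f fbm fI] := card_le_fun b bm.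
apply: (@card_le_trans _ _ _ (below m `*` [set: bool])).
  apply: (@fun_card_le _ _ (fun p : T * bool => (f p.1, p.2))).
    by move=> [x i] [/fbm].
  move=> [x i] [y j]; rewrite !inE /= => -[/= xb _] [/= yb _] [e ->].
  by congr pair; apply: fI; rewrite ?inE.
apply: card_le_trans (limit_card_le_setXbool lim) _.
by apply: subset_card_le => x; rewrite /below /= => /lt_le_trans; apply.
Qed.

End well_ordered.

Lemma sets_of_type_lt_card d (T : orderType d) d' (U : orderType d')
    (A : set T) :
  well_founded (fun x y : T => x < y) -> well_founded (fun x y : U => x < y) ->
  ~ ([set: U] #<= A) -> sets_of_type_lt U A.
Proof.
move=> wfT wfU UA.
have [u0] : exists u : U, True.
  apply: contrapT => nU; apply: UA.
  suff -> : [set: U] = set0 by exact: card_ge0.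
  by rewrite -subset0 => u _; apply: nU; exists u.
pose im (x : T) (rec : forall y, y < x -> U) : set U :=
  [set u | exists y (yx : y < x), A y /\ rec y yx = u].
pose least (B : set U) := xget u0 [set u | ~ B u /\ forall v, ~ B v -> u <= v].
pose f := Fix wfT (fun=> U) (fun x rec => least (im x rec)).
have fE x : f x = least (f @` (A `&` below x)).
  rewrite /f Fix_eq => [|y g h gh].
    congr least; apply/seteqP; split=> [u [y [yx [Ay <-]]]|u [y [Ay yx] <-]].
      by exists y.
    by exists y, yx.
  congr least; apply/seteqP; split=> u [z [zy [Az <-]]]; exists z, zy.
    by split=> //; rewrite gh.
  by split=> //; rewrite gh.
have leastP (B : set T) : B `<=` A -> ~ (f @` B) (least (f @` B)) /\
    forall v, ~ (f @` B) v -> least (f @` B) <= v.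
  move=> BA; suff : exists u, ~ (f @` B) u /\ forall v, ~ (f @` B) v -> u <= v.
    exact: xgetPex.
  have [|u uB umin] := wf_min wfU (A := ~` (f @` B)); last by exists u.
  apply: contrapT => nB.
  have fB u : ~ ~ (f @` B) u by move=> Bu; apply: nB; exists u.
  apply: UA; apply: card_le_trans (subset_card_le BA).
  apply: card_le_trans (card_image_le f B); apply: subset_card_le => u _.
  by apply: contrapT => /fB.
have flt x y : A x -> A y -> x < y -> f x < f y.
  move=> Ax Ay xy; rewrite lt_neqAle; apply/andP; split.
    rewrite [f y]fE; have [n _] := leastP (A `&` below y) (@subIsetl _ _ _).
    by apply/eqP => e; apply: n; exists x.
  rewrite [f x]fE; have [_] := leastP (A `&` below x) (@subIsetl _ _ _).
  apply; rewrite [f y]fE => -[z [Az zx] e].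
  have [n _] := leastP (A `&` below y) (@subIsetl _ _ _).
  by apply: n; exists z => //; split=> //; exact: lt_trans xy.
have [n1 n2] := leastP A (@subset_refl _ _).
exists (least (f @` A)), f; split; last first.
  move=> x y; rewrite !inE => Ax Ay; case: (ltgtP x y) => [xy|yx|->].
  - by rewrite ltW // flt.
  - by rewrite leNgt flt.
  - by rewrite lexx.
split.
- move=> x Ax; rewrite /below /= lt_neqAle; apply/andP; split.
    by apply/eqP => e; apply: n1; rewrite -e; exists x.
  rewrite [f x]fE; have [_] := leastP (A `&` below x) (@subIsetl _ _ _).
  by apply => -[y [Ay _] e]; apply: n1; rewrite -e; exists y.
- move=> x y; rewrite !inE => Ax Ay e.
  case: (ltgtP x y) => // xy.
    by have := flt _ _ Ax Ay xy; rewrite e ltxx.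
  by have := flt _ _ Ay Ax xy; rewrite e ltxx.
- move=> u; rewrite /below /= => uA; apply: contrapT => nu.
  by have := n2 u nu; rewrite leNgt uA.
Qed.

End cardinality_facts.

Section small_sets.
Context dK (K : orderType dK) dG (G : orderType dG).
Context (hK : infinite_cardinal K) (hG : infinite_cardinal G).

Lemma small_set0 : sets_of_type_lt G (set0 : set K).
Proof.
apply: sets_of_type_lt_card => [||/card_le_finite G0].
- exact: cardinal_wf hK.
- exact: cardinal_wf hG.
- by apply: (cardinal_infinite hG); apply: G0; exact: finite_set0.
Qed.

Lemma small_setU (A B : set K) :
  sets_of_type_lt G A -> sets_of_type_lt G B -> sets_of_type_lt G (A `|` B).
Proof.
move=> [a [f [[fA fI _] _]]] [b [g [[gB gI _] _]]].
pose m := Order.max a b.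
have AB : A `|` B #<= below m `*` [set: bool].
  pose h x := if `[< A x >] then (f x, true) else (g x, false).
  apply: (@fun_card_le _ _ h) => [x|x y].
    rewrite /h; case: asboolP => [Ax _|nAx [//|Bx]]; split=> //=.
      by rewrite /below /= lt_max (fA _ Ax).
    by rewrite /below /= lt_max [X in _ || X](gB _ Bx) orbT.
  rewrite !inE /h; case: asboolP => Ax; case: asboolP => Ay //= ABx ABy [].
    by apply: fI; rewrite inE.
  by apply: gI; rewrite inE; [case: ABx|case: ABy].
apply: sets_of_type_lt_card; [exact: cardinal_wf hK|exact: cardinal_wf hG|].
move=> /card_le_trans/(_ AB) Gm.
have [mfin|minf] := pselect (finite_set (below m)).
  apply: (cardinal_infinite hG); apply: card_le_finite Gm _.
  by apply: finite_setX => //; exact: finite_finset.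
have [_] := cardinal_initial hG m; apply; apply: card_le_trans Gm _.
exact: infinite_card_le_setXbool (cardinal_wf hG) _ minf.
Qed.

Definition small_Sigma : set (set (full_sets K)) :=
  Sigma (sets_of_type_lt G) (sets_of_type_lt G).

Lemma small_SigmaT : small_Sigma setT.
Proof.
apply/SigmaP => X _; exists set0, set0; split=> //; do ?exact: small_set0.
  exact: setI0.
by split; [exact: sub0set|exact: set0I].
Qed.

Lemma small_SigmaI : setI_closed small_Sigma.
Proof.
move=> U V /SigmaP hU /SigmaP hV; apply/SigmaP => X [/hU + /hV].
move=> [A [B [_ sA sB [AX BX] AB]]] [A' [B' [_ sA' sB' [AX' BX'] AB']]].
exists (A `|` A'), (B `|` B'); split; do ?exact: small_setU.
- rewrite /pattern -subset0 => x [Ax Bx].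
  have Xx : sval X x by case: Ax => [/AX|/AX'].
  by case: Bx => [Bx|Bx]; [rewrite -BX|rewrite -BX'].
- by split; [rewrite subUset|rewrite setIUl BX BX' setU0].
- move=> Y [AY]; rewrite setIUl => BY; split; [apply: AB|apply: AB']; split.
  + by move=> x ?; apply: AY; left.
  + by rewrite -subset0 -BY; exact: subsetUl.
  + by move=> x ?; apply: AY; right.
  + by rewrite -subset0 -BY; exact: subsetUr.
Qed.

Lemma small_Sigma_bigU (I : Type) (F : I -> set (full_sets K)) :
  (forall i, small_Sigma (F i)) -> small_Sigma (\bigcup_i F i).
Proof.
move=> hF; apply/SigmaP => X [i _ /((SigmaP _ _ _).1 (hF i))].
move=> [A [B [? ? ? ? sub]]]; exists A, B; split=> //.
by move=> Y /sub; exists i.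
Qed.

End small_sets.

(* [K]^K with the topology Sigma([K]^{<G}, [K]^{<G}); this family of sets is
   a topology because K and G are infinite cardinals, whence the arguments. *)
Definition Sigma_space dK (K : orderType dK) dG (G : orderType dG)
  (hK : infinite_cardinal K) (hG : infinite_cardinal G) : Type := full_sets K.

Section Sigma_topology.
Context dK (K : orderType dK) dG (G : orderType dG).
Context (hK : infinite_cardinal K) (hG : infinite_cardinal G).

HB.instance Definition _ := gen_eqMixin (Sigma_space hK hG).
HB.instance Definition _ := gen_choiceMixin (Sigma_space hK hG).
HB.instance Definition _ := isOpenTopological.Build (Sigma_space hK hG)
  (small_SigmaT hK hG) (@small_SigmaI _ _ _ _ hK hG)
  (@small_Sigma_bigU _ K _ G).

Lemma Sigma_space_openE : (@open (Sigma_space hK hG)) =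
  Sigma (sets_of_type_lt G) (sets_of_type_lt G).
Proof. by []. Qed.

End Sigma_topology.

(* c is constant on [H]^K *)
Definition homogeneous d (K : orderType d) C (c : full_sets K -> C)
    (H : set K) : Prop :=
  exists i, forall X : full_sets K, sval X `<=` H -> c X = i.

(* Main.v *)
(* Write gamma, kappa for G, K. If c is not constant on [kappa - S]^kappa, pick
   two sets X0, X1 avoiding S with different colours, decided by patterns
   (A0,B0) and (A1,B1), and let D be the union of these four sets. If a pattern
   (A,B) decides a colour, A misses D and B meets D only inside S, then (A,B) is
   compatible with both (A0,B0) and (A1,B1), which is absurd. So if no S of the
   allowed size works, choose D_i (i < gamma) by recursion for the sets
   S_i = U_{j<i} D_j, and take a pattern (A,B) deciding kappa - U_i D_i: then A
   misses every D_i, so B meets every D_i - S_i; these are gamma many disjoint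
   sets and |B| < gamma, a contradiction. *)
Require Import Defs.
From HB Require Import structures.
From mathcomp Require Import all_boot all_order.
From mathcomp Require Import all_classical topology.

Section homogeneous_sets.
Set Implicit Arguments.
Unset Strict Implicit.
Unset Printing Implicit Defensive.
Import Order.TTheory.
Local Open Scope order_scope.
Local Open Scope card_scope.
Local Open Scope classical_set_scope.

Lemma card_le_setX T T' U U' (A : set T) (B : set U) (A' : set T') (B' : set U') :
  A #<= B -> A' #<= B' -> A `*` A' #<= B `*` B'.
Proof.
move=> AB AB'.
(* [card_le_fun] needs a default point in the target, so the empty product is treated apart. *)
have [[[x x'] [/= Ax Ax']]|nAA] := pselect (A `*` A' !=set0); last first.
  suff -> : A `*` A' = set0 by exact: card_ge0.
  by rewrite -subset0 => p Ap; apply: nAA; exists p.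
have [u _] : B !=set0.
  by apply/set0P/eqP => B0; move: AB; rewrite B0 card_le0 => /eqP A0; rewrite A0 in Ax.
have [u' _] : B' !=set0.
  by apply/set0P/eqP => B0; move: AB'; rewrite B0 card_le0 => /eqP A0; rewrite A0 in Ax'.
have [f fAB fI] := card_le_fun u AB; have [g gAB gI] := card_le_fun u' AB'.
apply: (@fun_card_le _ _ (fun p => (f p.1, g p.2))).
  by move=> [y y'] [/= /fAB ? /gAB].
move=> [y y'] [z z']; rewrite !inE => -[/= Ay Ay'] [/= Az Az'] [e e'].
by congr pair; [apply: fI|apply: gI]; rewrite ?inE.
Qed.

(** * Recursion and collapse along a well-order *)

Section recursion.
Context d (T : orderType d) (wfT : well_founded (fun x y : T => x < y)).

Lemma wf_image_rec U (A : set T) (Phi : set U -> U) :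
  exists f : T -> U, forall x, f x = Phi (f @` (A `&` below x)).
Proof.
pose im x (rec : forall y, y < x -> U) : set U :=
  [set u | exists y (yx : y < x), A y /\ rec y yx = u].
pose f := Fix wfT (fun=> U) (fun x rec => Phi (im x rec)).
exists f => x; rewrite {1}/f Fix_eq => [|y g h gh]; congr Phi.
  apply/seteqP; split=> [u [y [yx [Ay <-]]]|u [y [Ay yx] <-]]; first by exists y.
  by exists y, yx.
by apply/seteqP; split=> u [z [zy [Az <-]]]; exists z, zy; rewrite gh.
Qed.

(** Each [x] goes to the least element of [B] not yet taken, which exists because the earlier values
    cannot exhaust [B]. By minimality the image is an initial segment of [B], which is the last
    clause. *)
Lemma wf_collapse d' (U : orderType d') (A : set T) (B : set U) (u0 : U) :
    well_founded (fun x y : U => x < y) ->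
    (forall x, A x -> ~ (B #<= A `&` below x)) ->
  exists f : T -> U, [/\ set_fun A B f,
    forall x y, A x -> A y -> x < y -> f x < f y &
    forall x v, A x -> B v -> v < f x -> exists2 y, A y & f y = v].
Proof.
move=> wfU AB.
pose least (C : set U) := xget u0 [set u | (B u /\ ~ C u) /\
  forall v, B v /\ ~ C v -> u <= v].
have [f fE] := wf_image_rec A least.
have fP x : A x -> (B (f x) /\ ~ (f @` (A `&` below x)) (f x)) /\
    forall v, B v /\ ~ (f @` (A `&` below x)) v -> f x <= v.
  move=> /AB nB; rewrite fE /least.
  set Q := [set u | _]; suff /(xgetPex u0) : exists u, Q u by [].
  have [|u ? ?] := wf_min wfU (A := B `\` (f @` (A `&` below x))); last by exists u.
  apply/set0P/eqP; rewrite setD_eq0 => /subset_card_le Bf; apply: nB.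
  exact: card_le_trans Bf (card_image_le _ _).
exists f; split.
- by move=> x /fP[[]].
- move=> x y Ax Ay xy; have [[Bfx nx] leastx] := fP _ Ax; have [[Bfy ny] _] := fP _ Ay.
  rewrite lt_neqAle; apply/andP; split; first by apply/eqP => e; apply: ny; exists x.
  apply: leastx; split=> // -[z [Az zx] e]; apply: ny; exists z => //.
  by split=> //; exact: lt_trans xy.
- move=> x v Ax Bv vx; have [_ leastx] := fP _ Ax.
  apply: contrapT => nv; move: vx; rewrite ltNge => /negP; apply; apply: leastx.
  by split=> // -[y [Ay _] e]; apply: nv; exists y.
Qed.

Lemma wf_collapse_card_le d' (U : orderType d') (A : set T) (B : set U) :
    well_founded (fun x y : U => x < y) ->
    (forall x, A x -> ~ (B #<= A `&` below x)) ->
  A #<= B.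
Proof.
move=> wfU AB.
have [[u0 _]|nU] := pselect ([set: U] !=set0); last first.
  have [->|/set0P[x /AB[]]] := eqVneq A set0; first exact: card_ge0.
  suff -> : B = set0 by exact: card_ge0.
  by rewrite -subset0 => u _; apply: nU; exists u.
have [f [fAB flt _]] := wf_collapse u0 wfU AB.
apply: (fun_card_le fAB) => x y; rewrite !inE => Ax Ay e.
case: (ltgtP x y) => // xy.
  by have := flt _ _ Ax Ay xy; rewrite e ltxx.
by have := flt _ _ Ay Ax xy; rewrite e ltxx.
Qed.

End recursion.

(** * The square of an infinite cardinal *)

Section product.
Context d (T : orderType d) (wfT : well_founded (fun x y : T => x < y)).

Lemma wf_lexi : well_founded (fun p q : T *lexi[d] T => p < q).
Proof.
move=> [x y]; elim/(well_founded_ind wfT): x y => x IHx.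
elim/(well_founded_ind wfT) => y IHy; constructor=> -[x' y'].
rewrite ltxi_pair; case: (ltgtP x' x) => [xx _|//|-> /= yy]; first exact: IHx.
exact: IHy.
Qed.

(* Hessenberg: order the triangle [y <= x < b] lexicographically; when [below b]
   has minimal cardinality, its proper initial segments are smaller than
   [below b], so that it collapses into [below b]. *)
Lemma infinite_card_le_setX (b : T) : infinite_set (below b) ->
  below b `*` below b #<= below b.
Proof.
elim/(well_founded_ind wfT): b => b IH binf.
have [[m [mb bm]]|initb] := pselect (exists m, m < b /\ below b #<= below m).
  have minf : infinite_set (below m) by move=> /(card_le_finite bm).
  apply: card_le_trans (card_le_setX bm bm) _.
  apply: card_le_trans (IH _ mb minf) _.
  by apply: subset_card_le => x /lt_trans; apply.
pose triangle : set (T *lexi[d] T) := [set p | p.2 <= p.1 /\ p.1 < b].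
have trib : triangle #<= below b.
  apply: (wf_collapse_card_le wf_lexi wfT) => -[x y] [/= _ xb] bQ.
  (* Pairs of the triangle below [(x, y)] have both coordinates in [Q]. *)
  pose Q := x |` below x.
  have {}bQ : below b #<= Q `*` Q.
    apply: card_le_trans bQ _; apply: subset_card_le => -[x' y'] [[/= y'x' _]].
    rewrite /below /= ltxi_pair => /andP[xx' _].
    suff Qle z : z <= x -> Q z by split; apply: Qle => //; exact: le_trans xx'.
    by rewrite le_eqVlt => /orP[/eqP|]; [left|right].
  have [xfin|xinf] := pselect (finite_set (below x)).
    have Qfin : finite_set Q by rewrite finite_setU; split=> //; exact: finite_set1.
    by apply: binf; apply: card_le_finite bQ _; exact: finite_setX.
  apply: initb; exists x; split=> //; apply: card_le_trans bQ _.
  have Qx := infinite_setU1_card_le x xinf.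
  exact: card_le_trans (card_le_setX Qx Qx) (IH _ xb xinf).
apply: card_le_trans (infinite_card_le_setXbool wfT binf).
apply: card_le_trans (card_le_setX trib (card_lexx _)).
(* The square folds into two copies of the triangle; the boolean records whether the coordinates
   were swapped. *)
pose h (p : T * T) : (T *lexi[d] T) * bool :=
  if p.2 <= p.1 then (p, true) else ((p.2, p.1), false).
apply: (@fun_card_le _ _ h) => [[x y] [/= xb yb]|[x y] [x' y'] _ _].
  rewrite /h /=; case: leP => [yx|/ltW xy]; by split.
by rewrite /h /=; case: leP => _; case: leP => _ [] // -> ->.
Qed.

End product.

(** * Cardinalities of small sets, their unions and complements *)

Section cardinals.
Context dK (K : orderType dK) dG (G : orderType dG).
Context (hK : infinite_cardinal K) (hG : infinite_cardinal G).

(** As [G] is an initial ordinal, smaller order type and smaller cardinality agree. *)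
Lemma small_card_lt (A : set K) :
  sets_of_type_lt G A <-> ~ ([set: G] #<= A).
Proof.
split; last by apply: sets_of_type_lt_card; [exact: cardinal_wf hK|exact: cardinal_wf hG].
move=> [u [f [[fA fI _] _]]] GA; have [_] := cardinal_initial hG u; apply.
exact: card_le_trans GA (fun_card_le fA fI).
Qed.

Lemma small_card_le (A : set K) : sets_of_type_lt G A -> A #<= [set: G].
Proof. by move=> [u [f [[_ fI _] _]]]; apply: (@fun_card_le _ _ f). Qed.

End cardinals.

Section two_cardinals.
Context dK (K : orderType dK) dG (G : orderType dG).
Context (hK : infinite_cardinal K) (hG : infinite_cardinal G).
Context (hGK : card_lt [set: G] [set: K]).

(** [K] is not the union of two smaller sets, so the complement has full cardinality. It collapses
    onto an initial segment of [K], which cannot be proper because [K] is an initial ordinal. *)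
Lemma card_le_setC_full (S : set K) : S #<= [set: G] -> sets_of_type K (~` S).
Proof.
move=> SG.
have KS : ~ ([set: K] #<= S) by move=> /card_le_trans/(_ SG); case: hGK.
have KC : [set: K] #<= ~` S.
  apply: contrapT => /(small_card_lt hK hK) sC.
  have := small_setU hK hK ((small_card_lt hK hK _).2 KS) sC.
  by rewrite setUv => /(small_card_lt hK hK); apply; exact: card_lexx.
have [k0 _] : [set: K] !=set0 by apply/set0P/eqP => K0; apply: KS; rewrite K0 card_ge0.
have [x _|f [fAB flt fdown]] := wf_collapse (A := ~` S) (B := [set: K])
    (cardinal_wf hK) k0 (cardinal_wf hK).
  move=> Kx; have [_] := cardinal_initial hK x; apply.
  by apply: card_le_trans Kx _; exact: subset_card_le.
exists f; split; last first.
  move=> x y; rewrite !inE => Ax Ay; case: (ltgtP x y) => [xy|yx|->].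
  - by rewrite ltW // flt.
  - by rewrite leNgt flt.
  - by rewrite lexx.
have fI : set_inj (~` S) f.
  move=> x y; rewrite !inE => Ax Ay e; case: (ltgtP x y) => // xy.
    by have := flt _ _ Ax Ay xy; rewrite e ltxx.
  by have := flt _ _ Ay Ax xy; rewrite e ltxx.
split=> // v _; apply: contrapT => nv.
have [_] := cardinal_initial hK v; apply; apply: card_le_trans KC _.
apply: (fun_card_le _ fI) => x Ax; rewrite /below /= ltNge; apply/negP.
rewrite le_eqVlt => /orP[/eqP e|/(fdown _ _ Ax I)[y Ay e]]; apply: nv.
  by exists x.
by exists y.
Qed.

(** [infinite_card_le_setX] concerns proper initial segments; since [G] is smaller than [K], it is
    equipotent with one in [K]. *)
Lemma card_le_setXT : [set: G] `*` [set: G] #<= [set: G].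
Proof.
have [_] := hGK; move=> /(sets_of_type_lt_card (cardinal_wf hG) (cardinal_wf hK)).
move=> [k [f [[fA fI fS] _]]].
have Gk : [set: G] #<= below k := fun_card_le fA fI.
have kG : below k #<= [set: G].
  by apply: card_le_trans (card_image_le f _); exact: subset_card_le.
apply: card_le_trans (card_le_setX Gk Gk) _; apply: card_le_trans kG.
apply: infinite_card_le_setX; first exact: cardinal_wf hK.
by move=> /(card_le_finite Gk); exact: cardinal_infinite hG.
Qed.

Lemma card_le_bigcup_small I (J : set I) (D : I -> set K) :
  J #<= [set: G] -> (forall i, sets_of_type_lt G (D i)) ->
  \bigcup_(i in J) D i #<= [set: G].
Proof.
move=> JG /(_ _)/small_card_le Ds; apply: card_le_trans card_le_setXT.
have [g0 _] : [set: G] !=set0.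
  by apply/set0P/eqP => G0; apply: (cardinal_infinite hG); rewrite G0.
have [i0|nI] := pselect (inhabited I); last first.
  suff -> : \bigcup_(i in J) D i = set0 by exact: card_ge0.
  by rewrite -subset0 => x [i]; case: nI.
case: i0 => i0; have [j jJ jI] := card_le_fun g0 JG.
have /choice[g gP] i : exists g : K -> G, set_inj (D i) g.
  by have [g] := card_le_fun g0 (Ds i); exists g.
have /choice[s sP] x : exists i, (\bigcup_(i in J) D i) x -> J i /\ D i x.
  by have [[i Ji Dix]|] := pselect ((\bigcup_(i in J) D i) x); [exists i|exists i0].
(* A point is coded by the index of a chosen set containing it and by its code within that set. *)
apply: (@fun_card_le _ _ (fun x => (j (s x), g (s x) x))) => // x y.
rewrite !inE => /sP[Jx Dx] /sP[Jy Dy] [e].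
have {}e : s x = s y by apply: jI; rewrite ?inE.
by rewrite e in Dx * => ?; apply: (gP (s y)); rewrite ?inE.
Qed.

Lemma regular_bounded (A : set G) : regular_cardinal G ->
  ~ ([set: G] #<= A) -> exists x, forall y, A y -> y < x.
Proof.
move=> [_ reg] nA; apply: contrapT => nb.
apply: (reg A); last exact/(small_card_lt hG hG).
move=> x; apply: contrapT => nx; apply: nb; exists x => y Ay.
by rewrite ltNge; apply/negP => xy; apply: nx; exists y.
Qed.

(** Otherwise [G] injects into the union. The indices sent into a given [D j] are bounded by some
    [b j], and these fewer than [G] bounds have a common bound [x]; then [x < b (s x) < x]. *)
Lemma regular_bigcup_small (i : G) (D : G -> set K) : regular_cardinal G ->
    (forall j, sets_of_type_lt G (D j)) ->
  sets_of_type_lt G (\bigcup_(j in below i) D j).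
Proof.
move=> reg Ds; apply/(small_card_lt hK hG) => GD.
have [k0 _] : [set: K] !=set0.
  by apply/set0P/eqP => K0; apply: (cardinal_infinite hK); rewrite K0.
have [f fD fI] := card_le_fun k0 GD.
have /choice[s sP] x : exists j, below i j /\ D j (f x).
  by have [j ij Dj] := fD x I; exists j.
have /choice[b bP] j : exists b, forall x, s x = j -> x < b.
  apply: (regular_bounded reg (A := [set x | s x = j])) => Gs.
  have /(small_card_lt hK hG) := Ds j; apply; apply: card_le_trans Gs _.
  apply: (@fun_card_le _ _ f) => [x <-|x y _ _]; first by have [] := sP x.
  by apply: fI; rewrite inE.
have [|x xP] := regular_bounded reg (A := b @` below i).
  move=> /card_le_trans/(_ (card_image_le _ _)).
  by have [] := cardinal_initial hG i.
have /(lt_trans (bP (s x) x erefl)) : b (s x) < x.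
  by apply: xP; exists (s x) => //; have [] := sP x.
by rewrite ltxx.
Qed.

(** * Patterns deciding a colour *)

Context (c : Sigma_space hK hG -> discrete_topology G) (hc : continuous c).

Lemma decided_by_pattern (X : full_sets K) : exists A B,
  [/\ sets_of_type_lt G A, sets_of_type_lt G B, bracket A B X &
      forall Y, bracket A B Y -> c Y = c X].
Proof.
have /continuousP/(_ [set c X]) := hc.
move=> /(_ (discrete_open _)); rewrite Sigma_space_openE => /SigmaP/(_ X erefl).
by move=> [A [B [_ ? ? ? AB]]]; exists A, B.
Qed.

Lemma decided_meets (S : set K) : ~ homogeneous c (~` S) ->
  exists D, sets_of_type_lt G D /\ forall (X : full_sets K) A B,
    sets_of_type_lt G A -> sets_of_type_lt G B -> bracket A B X ->
    (forall Y, bracket A B Y -> c Y = c X) ->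
    A `&` D = set0 -> ~ (B `&` D `<=` S).
Proof.
move=> nhom.
have avoid i : exists X : full_sets K, sval X `<=` ~` S /\ c X <> i.
  apply: contrapT => nX; apply: nhom; exists i => X XS.
  by apply: contrapT => cX; apply: nX; exists X.
have [g0 _] : [set: G] !=set0.
  by apply/set0P/eqP => G0; apply: (cardinal_infinite hG); rewrite G0.
have [X0 [X0S _]] := avoid g0; have [X1 [X1S c01]] := avoid (c X0).
have [A0 [B0 [sA0 sB0 X0AB c0]]] := decided_by_pattern X0.
have [A1 [B1 [sA1 sB1 X1AB c1]]] := decided_by_pattern X1.
exists ((A0 `|` B0) `|` (A1 `|` B1)); split.
  by apply: small_setU => //; exact: small_setU.
move=> X A B sA sB [AX BX] cAB AD BD; apply: c01.
suff agree X' A' B' : sval X' `<=` ~` S -> sets_of_type_lt G B' ->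
    bracket A' B' X' -> (forall Y, bracket A' B' Y -> c Y = c X') ->
    A' `|` B' `<=` A0 `|` B0 `|` (A1 `|` B1) -> c X' = c X.
  have -> := agree _ _ _ X1S sB1 X1AB c1 (@subsetUr _ _ _).
  by have -> := agree _ _ _ X0S sB0 X0AB c0 (@subsetUl _ _ _).
move=> X'S sB' [A'X' B'X'] c' sub.
(* The complement of [B] and [B'] matches both patterns: [A'] misses [B] since [B] meets [D] only in
   [S], which [X'] avoids, and [A] misses [B'] since [B'] lies in [D]. *)
have full : sets_of_type K (~` (B `|` B')).
  by apply: card_le_setC_full; apply: small_card_le; exact: small_setU.
pose Y : full_sets K := exist _ _ full.
have <- : c Y = c X'.
  apply: c'; split=> /=; last by rewrite -subset0 => x [B'x []]; right.
  move=> x A'x [Bx|B'x].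
    by apply: (X'S x (A'X' _ A'x)); apply: BD; split=> //; apply: sub; left.
  suff : (B' `&` sval X') x by rewrite B'X'.
  by split=> //; exact: A'X'.
apply: cAB; split=> /=; last by rewrite -subset0 => x [Bx []]; left.
move=> x Ax [Bx|B'x].
  suff : (B `&` sval X) x by rewrite BX.
  by split=> //; exact: AX.
suff : (A `&` (A0 `|` B0 `|` (A1 `|` B1))) x by rewrite AD.
by split=> //; apply: sub; right.
Qed.

(** [P] collects the admissible exceptional sets, so that both halves of the theorem are instances:
    size at most [G] in general, less than [G] in the regular case. *)
Lemma homogeneous_of_ideal (P : set (set K)) :
    (forall D : G -> set K, (forall i, sets_of_type_lt G (D i)) ->
      forall i, P (\bigcup_(j in below i) D j)) ->
  exists2 S, P S & homogeneous c (~` S).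
Proof.
move=> Pcup; apply: contrapT => nhom.
(* The recursion needs a total [Phi]: the empty set is the default when the union is not in [P]. *)
have /choice[Phi PhiP] (F : set (set K)) : exists D, sets_of_type_lt G D /\
    (P (\bigcup_(E in F) E) -> forall (X : full_sets K) A B,
    sets_of_type_lt G A -> sets_of_type_lt G B -> bracket A B X ->
    (forall Y, bracket A B Y -> c Y = c X) ->
    A `&` D = set0 -> ~ (B `&` D `<=` \bigcup_(E in F) E)).
  have [PF|nPF] := pselect (P (\bigcup_(E in F) E)); last first.
    by exists set0; split=> //; exact: small_set0.
  have [|D [sD DP]] := @decided_meets (\bigcup_(E in F) E); last by exists D.
  by move=> homF; apply: nhom; exists (\bigcup_(E in F) E).
have [D DE] := wf_image_rec (cardinal_wf hG) setT Phi.
have sD i : sets_of_type_lt G (D i) by rewrite DE; case: (PhiP (D @` (setT `&` below i))).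
have full : sets_of_type K (~` \bigcup_(i in setT) D i).
  by apply: card_le_setC_full; apply: card_le_bigcup_small => //; exact: card_lexx.
pose X : full_sets K := exist _ _ full.
have [A [B [sA sB XAB cAB]]] := decided_by_pattern X.
have AD i : A `&` D i = set0.
  by have [AX _] := XAB; rewrite -subset0 => x [/AX nDx Dix]; apply: nDx; exists i.
(* The index [i] is the first one with [b i] in [D i], so [b] injects [G] into [B]. *)
have /choice[b bP] i : exists b, [/\ B b, D i b & forall j, j < i -> ~ D j b].
  have [_] := PhiP (D @` (setT `&` below i)).
  rewrite -DE bigcup_image setTI => /(_ (Pcup _ sD i) X A B sA sB XAB cAB (AD i)).
  move=> nsub; apply: contrapT => nb; apply: nsub => x [Bx Dix].
  apply: contrapT => nDx; apply: nb; exists x; split=> // j ji Djx.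
  by apply: nDx; exists j.
have /(small_card_lt hK hG) := sB; apply.
apply: (@fun_card_le _ _ b) => [i _|i j _ _ e]; first by have [] := bP i.
have [_ Di ni] := bP i; have [_ Dj nj] := bP j.
case: (ltgtP i j) => // [/nj|/ni]; first by rewrite -e.
by rewrite e.
Qed.

End two_cardinals.
End homogeneous_sets.

Theorem theorem2p1 (dK dG : Order.disp_t) (K : orderType dK) (G : orderType dG)
    (hK : infinite_cardinal K) (hG : infinite_cardinal G)
    (hGK : card_lt [set: G] [set: K])
    (c : Sigma_space hK hG -> discrete_topology G) (hc : continuous c) :
  (exists H : set K,
      [/\ sets_of_type K H, homogeneous c H & card_le (~` H) [set: G]]) /\
  (regular_cardinal G ->
    exists H : set K,
      [/\ sets_of_type K H, homogeneous c H & card_lt (~` H) [set: G]]).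
Proof.
split=> [|reg].
  have [|S SG homS] := homogeneous_of_ideal hGK hc (P := [set S | card_le S [set: G]]).
    by move=> D sD i; apply: card_le_bigcup_small => //; exact: subset_card_le.
  by exists (~` S)%classic; rewrite setCK; split=> //; exact: card_le_setC_full SG.
have [D sD i|S sS homS] := homogeneous_of_ideal hGK hc (P := sets_of_type_lt G).
  exact: regular_bigcup_small.
exists (~` S)%classic; rewrite setCK; have SG := small_card_le sS; split=> //.
  exact: card_le_setC_full SG.
by split=> //; exact/small_card_lt.
Qed.
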